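(* Let $\beta\in\{1,2,4\}$, $n\ge1$. For every integer $N\ge1$ and all $q_1,\dots,q_n\ge0$ with $q_1+\dots+q_n\le1$, the binomial ensemble $\mathrm{Bin}(N,q_1,\dots,q_n)$ on $\mathbb{H}_{n,\beta}$ is a Meixner ensemble with parameters $A=-\frac1{2N-1}$, $B=\frac{2N}{2N-1}$, $C=0$.
   Context: For $\beta=1,2,4$, $\mathbb{H}_{n,\beta}$ is the real vector space of $n\times n$ real symmetric, complex Hermitian, respectively quaternionic Hermitian matrices; $\mathcal{K}_{n,\beta}$ is $O(n)$, $U(n)$, $Sp(n)$ (quaternionic unitary matrices) respectively. A law $\mu$ on $\mathbb{H}_{n,\beta}$ is rotation invariant if $U\mathbf XU^*\sim\mathbf X$ for all $U\in\mathcal{K}_{n,\beta}$ when $\mathbf X\sim\mu$. $\mu$ is a Meixner ensemble with parameters $A,B,C\in\mathbb R$ if it is rotation invariant, has finite second moments, and for $\mathbf X,\mathbf Y$ independent with law $\mu$ and $\mathbf S=\mathbf X+\mathbf Y$ one has $\mathbb{E}((\mathbf X-\mathbf Y)^2|\mathbf S)=A\mathbf S^2+B\mathbf S+C\mathbf I_n$. Let $\mathbf I_{m,n}$ be the $n\times n$ diagonal matrix with $m$ ones followed by $n-m$ zeros and let $\mu_m$ be the law of $\mathbf U\mathbf I_{m,n}\mathbf U^*$ with $\mathbf U$ Haar distributed on $\mathcal{K}_{n,\beta}$. The Bernoulli ensemble with parameters $q_1,\dots,q_n\ge0$, $q_1+\dots+q_n\le1$, is the law $q_0\delta_{\mathbf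 0}+q_1\mu_1+\dots+q_{n-1}\mu_{n-1}+q_n\delta_{\mathbf I_n}$ with $q_0=1-(q_1+\dots+q_n)$. $\mathrm{Bin}(N,q_1,\dots,q_n)$ is the law of $\mathbf X_1+\dots+\mathbf X_N$ with $\mathbf X_1,\dots,\mathbf X_N$ independent with this Bernoulli law. *)

(* Defs.v *)
From HB Require Import structures.
From mathcomp Require Import all_boot all_order all_algebra.
From mathcomp Require Import ring.
From mathcomp Require Import all_classical all_reals all_analysis.
From mathcomp Require Import complex.

Set Implicit Arguments.
Unset Strict Implicit.
Unset Printing Implicit Defensive.

Import Order.TTheory GRing.Theory Num.Theory.
Local Open Scope classical_set_scope.
Local Open Scope ring_scope.

Record quaternion (R : Type) := Quaternion
  { qre : R ; qi : R ; qj : R ; qk : R }.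

Section quaternion_ring.
Variable R : realType.
Local Notation H := (quaternion R).

Definition quat_tuple (x : H) := (qre x, qi x, qj x, qk x).
Definition tuple_quat (t : R * R * R * R) : H :=
  let: (a, b, c, d) := t in Quaternion a b c d.
Lemma quat_tupleK : cancel quat_tuple tuple_quat. Proof. by case. Qed.
HB.instance Definition _ := Choice.copy H (can_type quat_tupleK).

Lemma quatP (x y : H) : qre x = qre y -> qi x = qi y -> qj x = qj y ->
  qk x = qk y -> x = y.
Proof. by case: x y => [? ? ? ?] [? ? ? ?] /= -> -> -> ->. Qed.

Definition quat0 : H := Quaternion 0 0 0 0.
Definition quat1 : H := Quaternion 1 0 0 0.
Definition quat_opp (x : H) : H :=
  Quaternion (- qre x) (- qi x) (- qj x) (- qk x).
Definition quat_add (x y : H) : H :=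
  Quaternion (qre x + qre y) (qi x + qi y) (qj x + qj y) (qk x + qk y).
Definition quat_mul (x y : H) : H := Quaternion
  (qre x * qre y - qi x * qi y - qj x * qj y - qk x * qk y)
  (qre x * qi y + qi x * qre y + qj x * qk y - qk x * qj y)
  (qre x * qj y - qi x * qk y + qj x * qre y + qk x * qi y)
  (qre x * qk y + qi x * qj y - qj x * qi y + qk x * qre y).
Definition quat_conj (x : H) : H :=
  Quaternion (qre x) (- qi x) (- qj x) (- qk x).

Lemma quat_addA : associative quat_add.
Proof. by move=> x y z; apply: quatP => /=; rewrite addrA. Qed.
Lemma quat_addC : commutative quat_add.
Proof. by move=> x y; apply: quatP => /=; rewrite addrC. Qed.
Lemma quat_add0 : left_id quat0 quat_add.
Proof. by move=> x; apply: quatP => /=; rewrite add0r. Qed.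
Lemma quat_addN : left_inverse quat0 quat_opp quat_add.
Proof. by move=> x; apply: quatP => /=; rewrite addNr. Qed.
HB.instance Definition _ :=
  GRing.isZmodule.Build H quat_addA quat_addC quat_add0 quat_addN.

Lemma quat_mulA : associative quat_mul.
Proof. by move=> x y z; apply: quatP => /=; ring. Qed.
Lemma quat_mul1l : left_id quat1 quat_mul.
Proof. by move=> x; apply: quatP => /=; ring. Qed.
Lemma quat_mul1r : right_id quat1 quat_mul.
Proof. by move=> x; apply: quatP => /=; ring. Qed.
Lemma quat_mulDl : left_distributive quat_mul +%R.
Proof. by move=> x y z; apply: quatP => /=; ring. Qed.
Lemma quat_mulDr : right_distributive quat_mul +%R.
Proof. by move=> x y z; apply: quatP => /=; ring. Qed.
Lemma quat_1neq0 : quat1 != 0.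
Proof. by apply/eqP => /(congr1 (@qre R)) /= /eqP; rewrite oner_eq0. Qed.
HB.instance Definition _ := GRing.Zmodule_isNzRing.Build H
  quat_mulA quat_mul1l quat_mul1r quat_mulDl quat_mulDr quat_1neq0.
End quaternion_ring.

(* The scalars for the Dyson index beta; every beta other than 1 and 2 gives
   the quaternions, and only beta = 1, 2, 4 are meant. *)
Definition dscalar (R : realType) (beta : nat) : nzRingType :=
  match beta with
  | 1%N => R
  | 2%N => R[i]
  | _ => quaternion R
  end.

Definition sconj (R : realType) (beta : nat) : dscalar R beta -> dscalar R beta :=
  match beta return dscalar R beta -> dscalar R beta with
  | 1%N => id
  | 2%N => Num.conj
  | _ => @quat_conj R
  end.

Definition of_real (R : realType) (beta : nat) : R -> dscalar R beta :=
  match beta return R -> dscalar R beta with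
  | 1%N => id
  | 2%N => fun a => a%:C%C
  | _ => fun a => Quaternion a 0 0 0
  end.

Definition scoords (R : realType) (beta : nat) : dscalar R beta -> seq R :=
  match beta return dscalar R beta -> seq R with
  | 1%N => fun x => [:: x]
  | 2%N => fun x => [:: complex.Re x; complex.Im x]
  | _ => fun x => [:: qre x; qi x; qj x; qk x]
  end.

(* The k-th real coordinate of a scalar (0 when k >= beta). *)
Definition scoord (R : realType) (beta : nat) (k : nat) (x : dscalar R beta) : R :=
  (scoords x)`_k.

Definition mat (R : realType) (beta n : nat) : Type := 'M[dscalar R beta]_n.

(* The Borel sigma-algebra of the finite-dimensional real vector space
   mat R beta n, generated by its real coordinates. *)
Definition mat_cylinder (R : realType) (beta n : nat) : set (set (mat R beta n)) :=
  [set A | exists (i j : 'I_n) (k : nat) (B : set R), measurable B /\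
     A = (fun X : mat R beta n => scoord k (X i j)) @^-1` B].

Section mat_instances.
Variables (R : realType) (beta n : nat).
HB.instance Definition _ := GRing.Zmodule.on (mat R beta n).
HB.instance Definition _ := isPointed.Build (mat R beta n) 0.
HB.instance Definition _ := Measurable.copy (mat R beta n)
  (g_sigma_algebraType (@mat_cylinder R beta n)).
End mat_instances.

Definition adjmx_conj (R : realType) (beta n : nat) (X : mat R beta n) :
  mat R beta n := (map_mx (@sconj R beta) X)^T.

Definition rscale (R : realType) (beta n : nat) (a : R) (X : mat R beta n) :
  mat R beta n := of_real beta a *: (X : 'M[dscalar R beta]_n).

(* H_{n,beta}; a law on it is a law on mat R beta n giving it mass 1. *)
Definition herm_mats (R : realType) (beta n : nat) : set (mat R beta n) :=
  [set X | adjmx_conj X = X].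

(* The group K_{n,beta}, i.e. O(n), U(n) or Sp(n) *)
Definition unitary_mats (R : realType) (beta n : nat) : set (mat R beta n) :=
  [set U | U *m adjmx_conj U = 1%:M /\ adjmx_conj U *m U = 1%:M].

Definition rotate_mat (R : realType) (beta n : nat) (U X : mat R beta n) :
  mat R beta n := U *m X *m adjmx_conj U.

(* The Haar probability measure of the compact group K_{n,beta}, as a measure
   on the ambient matrix space carried by the group. *)
Definition is_haar (R : realType) (beta n : nat)
    (h : probability (mat R beta n) R) : Prop :=
  h (@unitary_mats R beta n) = 1%E /\
  forall V : mat R beta n, unitary_mats V ->
  forall A : set (mat R beta n), measurable A ->
  h ((fun U : mat R beta n => V *m U : mat R beta n) @^-1` A) = h A.

Definition rotation_invariant (R : realType) (beta n : nat)
    (mu : probability (mat R beta n) R) : Prop :=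
  forall U : mat R beta n, unitary_mats U ->
  forall A, measurable A -> mu (rotate_mat U @^-1` A) = mu A.

Definition finite_second_moments (R : realType) (beta n : nat)
    (mu : probability (mat R beta n) R) : Prop :=
  forall (i j : 'I_n) (k : nat),
    (\int[mu]_X ((scoord k (X i j)) ^+ 2)%:E < +oo)%E.

Definition has_law (R : realType) (d d' : measure_display)
    (Omega : measurableType d) (T : measurableType d')
    (P : probability Omega R) (X : {RV P >-> T}) (mu : set T -> \bar R) : Prop :=
  forall A, measurable A -> distribution P X A = mu A.

Definition independent2 (R : realType) (d d' : measure_display)
    (Omega : measurableType d) (T : measurableType d')
    (P : probability Omega R) (X Y : {RV P >-> T}) : Prop :=
  forall A B, measurable A -> measurable B ->
  P (X @^-1` A `&` Y @^-1` B) = (P (X @^-1` A) * P (Y @^-1` B))%E.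

Definition mutually_independent (R : realType) (d d' : measure_display)
    (Omega : measurableType d) (T : measurableType d')
    (P : probability Omega R) (N : nat) (X : 'I_N -> {RV P >-> T}) : Prop :=
  forall (J : {set 'I_N}) (A : 'I_N -> set T), (forall i, measurable (A i)) ->
  P (\bigcap_(i in [set` J]) (X i @^-1` A i)) =
  (\prod_(i in J) P (X i @^-1` A i))%E.

Definition sigma_gen (d d' : measure_display)
    (Omega : measurableType d) (T : measurableType d') (S : Omega -> T) :
    set (set Omega) := preimage_set_system setT S measurable.

Definition is_cond_exp (R : realType) (d d' : measure_display)
    (Omega : measurableType d) (T : measurableType d')
    (P : probability Omega R) (S : Omega -> T) (Z W : Omega -> R) : Prop :=
  [/\ P.-integrable setT (EFin \o Z),
      P.-integrable setT (EFin \o W),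
      forall B : set R, measurable B -> sigma_gen S (W @^-1` B)
    & forall G, sigma_gen S G ->
      (\int[P]_(w in G) (W w)%:E = \int[P]_(w in G) (Z w)%:E)%E].

Definition is_mat_cond_exp (R : realType) (beta n : nat) (d d' : measure_display)
    (Omega : measurableType d) (T : measurableType d')
    (P : probability Omega R) (S : Omega -> T) (Z W : Omega -> mat R beta n) :
    Prop :=
  forall (i j : 'I_n) (k : nat),
    is_cond_exp P S (fun w => scoord k (Z w i j)) (fun w => scoord k (W w i j)).

Definition is_meixner (R : realType) (beta n : nat)
    (mu : probability (mat R beta n) R) (A B C : R) : Prop :=
  [/\ mu (@herm_mats R beta n) = 1%E,
      rotation_invariant mu,
      finite_second_moments mu
    & forall (d : measure_display) (Omega : measurableType d)
        (P : probability Omega R) (X Y : {RV P >-> mat R beta n}),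
      independent2 X Y -> has_law X mu -> has_law Y mu ->
      let S w : mat R beta n := X w + Y w in
      let D w : mat R beta n := X w - Y w in
      is_mat_cond_exp P S (fun w => D w *m D w)
        (fun w => rscale A (S w *m S w) + rscale B (S w) + rscale C 1%:M)].

Definition partial_id (R : realType) (beta n m : nat) : mat R beta n := pid_mx m.

(* mu_m, the law of U I_{m,n} U^* for U with law h *)
Definition projection_law (R : realType) (beta n : nat)
    (h : probability (mat R beta n) R) (m : nat) : set (mat R beta n) -> \bar R :=
  pushforward h (fun U => rotate_mat U (partial_id R beta n m)).

(* Only the values q 1, ..., q n are used. *)
Definition bernoulli_ensemble (R : realType) (beta n : nat)
    (h : probability (mat R beta n) R) (q : nat -> R) (A : set (mat R beta n)) :
    \bar R :=
  ((1 - \sum_(1 <= m < n.+1) q m)%:E * \d_(0%R : mat R beta n) A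
   + \sum_(1 <= m < n) (q m)%:E * projection_law h m A
   + (q n)%:E * \d_((1%:M)%R : mat R beta n) A)%E.

Definition is_binomial_ensemble (R : realType) (beta n : nat)
    (h : probability (mat R beta n) R) (N : nat) (q : nat -> R)
    (mu : probability (mat R beta n) R) : Prop :=
  exists (d : measure_display) (Omega : measurableType d)
    (P : probability Omega R) (X : 'I_N -> {RV P >-> mat R beta n}),
  [/\ mutually_independent X,
      forall i, has_law (X i) (bernoulli_ensemble h q)
    & forall A, measurable A ->
      mu A = pushforward P (fun w => \sum_(i < N) X i w) A].

(* Main.v *)
(* Bin(N, q) is the law of a sum of N independent random orthogonal projections,
   so X and Y can be realized as the sums of two disjoint groups of N among 2N
   i.i.d. projections F_p. By exchangeability K = E(F_p F_p' | S) is the same for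
   all p <> p', while F_p F_p = F_p. Expanding the squares gives
   E(S^2 | S) = S + 2N(2N-1) K, hence K = (S^2 - S) / (2N(2N-1)), and
   E((X-Y)^2 | S) = S - 2N K, because the signs of the two groups sum to 0. *)

From HB Require Import structures.
Require Import Defs.
From mathcomp Require Import all_boot all_order all_fingroup all_algebra.
From mathcomp Require Import ring lra.
From mathcomp Require Import all_classical all_reals all_analysis.
From mathcomp Require Import measurable_realfun complex.

Set Implicit Arguments.
Unset Strict Implicit.
Unset Printing Implicit Defensive.

Import Order.TTheory GRing.Theory Num.Theory.
Local Open Scope classical_set_scope.
Local Open Scope ring_scope.

(** The conditional expectation in the definition lives on an arbitrary space where [X] and [Y] are
    known only through their law, and no decomposition into projections need exist there. Its
    defining identity, however, only compares integrals of functions of the pair [(X, Y)], so it can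
    be checked on any independent pair with law [mu]; two copies of the family of projections, on
    the product of their space with itself, provide one. On that space no conditional expectation is
    formed: for a fixed measurable [A], integrals over the event [S \in A] replace [E( . | S)], and
    [K] becomes one number for each matrix entry and real coordinate. Matrices do not commute, but
    exchangeability carries any ordered pair of distinct indices to any other, so [F_p F_p'] and
    [F_p' F_p] have the same restricted mean. All these integrals converge because the entries of an
    orthogonal projection are bounded by 1. *)

(** * Real coordinates of real, complex and quaternionic scalars *)

Section scalars.
Variables (R : realType) (beta : nat).
Implicit Types x y : dscalar R beta.

Lemma scoordD k x y : scoord k (x + y) = scoord k x + scoord k y.
Proof.
rewrite /scoord; case: beta x y => [|[|[|b]]] /= x y.
- by case: k => [|[|[|[|k]]]] //=; rewrite ?nth_nil ?addr0.
- by case: k => [|k] //=; rewrite ?nth_nil ?addr0.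
- by case: x y => [a b] [c d]; case: k => [|[|k]] //=; rewrite ?nth_nil ?addr0.
- by case: k => [|[|[|[|k]]]] //=; rewrite ?nth_nil ?addr0.
Qed.

Lemma scoordN k x : scoord k (- x) = - scoord k x.
Proof.
rewrite /scoord; case: beta x => [|[|[|b]]] /= x.
- by case: k => [|[|[|[|k]]]] //=; rewrite ?nth_nil ?oppr0.
- by case: k => [|k] //=; rewrite ?nth_nil ?oppr0.
- by case: x => [a b]; case: k => [|[|k]] //=; rewrite ?nth_nil ?oppr0.
- by case: k => [|[|[|[|k]]]] //=; rewrite ?nth_nil ?oppr0.
Qed.

Lemma scoord0 k : scoord k (0 : dscalar R beta) = 0.
Proof. by apply: (addrI (scoord k (0 : dscalar R beta))); rewrite -scoordD !addr0. Qed.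

Lemma scoord_sum k (I : Type) (r : seq I) (P : pred I) (f : I -> dscalar R beta) :
  scoord k (\sum_(i <- r | P i) f i) = \sum_(i <- r | P i) scoord k (f i).
Proof.
exact: (big_morph (@scoord R beta k) (scoordD k) (scoord0 k)).
Qed.

Lemma scoord_of_real k a x : scoord k (of_real beta a * x) = a * scoord k x.
Proof.
rewrite /scoord; case: beta x => [|[|[|b]]] /= x.
- case: k => [|[|[|[|k]]]] //=; rewrite ?nth_nil ?mulr0 //; ring.
- by case: k => [|k] //=; rewrite ?nth_nil ?mulr0.
- by case: x => [c d]; case: k => [|[|k]] //=; rewrite ?nth_nil ?mulr0 //; ring.
- case: k => [|[|[|[|k]]]] //=; rewrite ?nth_nil ?mulr0 //; ring.
Qed.

Lemma scoord_inj x y : (forall k : 'I_4, scoord k x = scoord k y) -> x = y.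
Proof.
move=> xy; have {}xy k : (k < 4)%N -> scoord k x = scoord k y.
  by move=> k4; apply: (xy (Ordinal k4)).
move: (xy 0%N isT) (xy 1%N isT) (xy 2%N isT) (xy 3%N isT) => {xy}.
rewrite /scoord; case: beta x y => [|[|[|b]]] /= x y.
- exact: quatP.
- by [].
- by case: x y => [a b] [c d] /= -> ->.
- exact: quatP.
Qed.

Lemma sconjD x y : sconj (x + y) = sconj x + sconj y.
Proof.
case: beta x y => [|[|[|b]]] /= x y; rewrite ?rmorphD //.
- by apply: quatP => //=; rewrite opprD.
- by apply: quatP => //=; rewrite opprD.
Qed.

Lemma sconjM x y : sconj (x * y) = sconj y * sconj x.
Proof.
case: beta x y => [|[|[|b]]] /= x y.
- by apply: quatP => /=; ring.
- by rewrite mulrC.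
- by rewrite rmorphM mulrC.
- by apply: quatP => /=; ring.
Qed.

Lemma sconj1 : sconj (1 : dscalar R beta) = 1.
Proof.
case: beta => [|[|[|b]]] //=; rewrite ?rmorph1 //.
- by apply: quatP => //=; rewrite oppr0.
- by apply: quatP => //=; rewrite oppr0.
Qed.

Lemma sconj0 : sconj (0 : dscalar R beta) = 0.
Proof.
by apply: (addrI (sconj (0 : dscalar R beta))); rewrite -sconjD !addr0.
Qed.

Lemma sconj_sum (I : Type) (r : seq I) (P : pred I) (f : I -> dscalar R beta) :
  sconj (\sum_(i <- r | P i) f i) = \sum_(i <- r | P i) sconj (f i).
Proof. exact: (big_morph (@sconj R beta) sconjD sconj0). Qed.

(** Multiplication is real bilinear, so its structure constants give every coordinate. Sums over
    ['I_4] serve all [beta] because surplus coordinates are 0, and later closure arguments need no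
    case analysis on [beta]. *)
Lemma scoordM k : exists c : 'I_4 -> 'I_4 -> R, forall x y,
  scoord k (x * y) = \sum_i \sum_j c i j * (scoord i x * scoord j y).
Proof.
(* The units 1, i, j, k: the structure constants are the coordinates of products of units. *)
pose q (i : 'I_4) : quaternion R := Quaternion (i == 0 :> nat)%:R (i == 1 :> nat)%:R
  (i == 2 :> nat)%:R (i == 3 :> nat)%:R.
case: beta => [|[|[|b]]].
- exists (fun i j => scoord k (q i * q j : dscalar R 0)) => x y.
  rewrite !big_ord_recl !big_ord0 /= /scoord /=.
  by case: k => [|[|[|[|k]]]] /=; rewrite ?nth_nil; ring.
- exists (fun i j =>
    scoord k (((i == 0 :> nat) && (j == 0 :> nat))%:R : dscalar R 1)) => x y.
  rewrite !big_ord_recl !big_ord0 /= /scoord /=.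
  by case: k => [|k] /=; rewrite ?nth_nil; ring.
- pose z (i : 'I_4) : R[i] := Complex (i == 0 :> nat)%:R (i == 1 :> nat)%:R.
  exists (fun i j => scoord k (z i * z j : dscalar R 2)) => -[a b] [c d].
  rewrite !big_ord_recl !big_ord0 /= /scoord /=.
  by case: k => [|[|k]] /=; rewrite ?nth_nil; ring.
- exists (fun i j => scoord k (q i * q j : dscalar R 4)) => x y.
  rewrite !big_ord_recl !big_ord0 /= /scoord /=.
  by case: k => [|[|[|[|k]]]] /=; rewrite ?nth_nil; ring.
Qed.

Lemma scoord_conj k x : scoord k (sconj x) = (-1) ^+ (0 < k)%N * scoord k x.
Proof.
rewrite /scoord; case: beta x => [|[|[|b]]] /= x.
- by case: k => [|[|[|[|k]]]] //=; rewrite ?nth_nil ?mulr0 ?expr0 ?mul1r ?mulN1r.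
- by case: k => [|k] //=; rewrite ?nth_nil ?mulr0 ?mul1r.
- by case: x => [c d]; case: k => [|[|k]] //=; rewrite ?nth_nil ?mulr0 ?mul1r ?mulN1r.
- by case: k => [|[|[|[|k]]]] //=; rewrite ?nth_nil ?mulr0 ?expr0 ?mul1r ?mulN1r.
Qed.

(** The real part of [x * sconj x] is the sum of the squares of all coordinates of [x]. *)
Lemma scoord_mul_conj_ge k x : scoord k x ^+ 2 <= scoord 0 (x * sconj x).
Proof.
rewrite /scoord; case: beta x => [|[|[|b]]] /= x.
- by case: k => [|[|[|[|k]]]] //=; rewrite ?nth_nil; nra.
- by case: k => [|k] //=; rewrite ?nth_nil; nra.
- by case: x => [c d]; case: k => [|[|k]] //=; rewrite ?nth_nil //=; nra.
- by case: k => [|[|[|[|k]]]] //=; rewrite ?nth_nil; nra.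
Qed.

End scalars.

(* Measurability and boundedness of matrix expressions are both obtained by
   checking that they define an algebra of real functions. *)
Record fun_alg (R : realType) (T : Type) (P : (T -> R) -> Prop) : Prop := FunAlg
  { fun_alg_cst : forall a, P (fun _ => a) ;
    fun_algD : forall f g, P f -> P g -> P (fun t => f t + g t) ;
    fun_algM : forall f g, P f -> P g -> P (fun t => f t * g t) }.

(** * Matrix operations inside an algebra of real functions *)

Section fun_alg_scalars.
Variables (R : realType) (beta : nat) (T : Type) (P : (T -> R) -> Prop).
Hypothesis PA : fun_alg P.

Lemma fun_algN f : P f -> P (fun t => - f t).
Proof.
move=> Pf; have := fun_algM PA (fun_alg_cst PA (-1)) Pf.
by under eq_fun do rewrite mulN1r.
Qed.

Lemma fun_alg_sum (I : Type) (r : seq I) (Q : pred I) (f : I -> T -> R) :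
  (forall i, P (f i)) -> P (fun t => \sum_(i <- r | Q i) f i t).
Proof.
move=> Pf; elim: r => [|i r IH].
  by under eq_fun do rewrite big_nil; exact: fun_alg_cst PA _.
under eq_fun do rewrite big_cons; case: (Q i) => //; exact: fun_algD PA _ _ _ _.
Qed.

Lemma fun_alg_scoordM (f g : T -> dscalar R beta) :
  (forall k, P (fun t => scoord k (f t))) -> (forall k, P (fun t => scoord k (g t))) ->
  forall k, P (fun t => scoord k (f t * g t)).
Proof.
move=> Pf Pg k; have [c cE] := @scoordM R beta k.
under eq_fun do rewrite cE.
apply: fun_alg_sum => i; apply: fun_alg_sum => j.
by apply: (fun_algM PA (fun_alg_cst PA _)); exact: fun_algM PA _ _ _ _.
Qed.

Definition mx_in n (f : T -> mat R beta n) :=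
  forall i j k, P (fun t => scoord k (f t i j)).

Variable n : nat.
Implicit Types f g : T -> mat R beta n.

Lemma mx_in_cst (X : mat R beta n) : mx_in (fun _ => X).
Proof. by move=> i j k; exact: fun_alg_cst PA _. Qed.

Lemma mx_inD f g : mx_in f -> mx_in g -> mx_in (fun t => f t + g t).
Proof.
move=> Pf Pg i j k; under eq_fun do rewrite mxE scoordD.
exact: fun_algD PA _ _ (Pf _ _ _) (Pg _ _ _).
Qed.

Lemma mx_inN f : mx_in f -> mx_in (fun t => - f t).
Proof.
move=> Pf i j k; under eq_fun do rewrite mxE scoordN.
exact: fun_algN (Pf _ _ _).
Qed.

Lemma mx_in_sum (I : Type) (r : seq I) (Q : pred I) (f : I -> T -> mat R beta n) :
  (forall i, mx_in (f i)) -> mx_in (fun t => \sum_(i <- r | Q i) f i t).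
Proof.
move=> Pf; elim: r => [|i r IH].
  by under eq_fun do rewrite big_nil; exact: mx_in_cst.
under eq_fun do rewrite big_cons; case: (Q i) => //; exact: mx_inD.
Qed.

Lemma mx_inM f g : mx_in f -> mx_in g -> mx_in (fun t => f t *m g t : mat R beta n).
Proof.
move=> Pf Pg i j k; under eq_fun do rewrite mxE scoord_sum.
by apply: fun_alg_sum => l; apply: fun_alg_scoordM.
Qed.

Lemma mx_in_adj f : mx_in f -> mx_in (fun t => adjmx_conj (f t)).
Proof.
move=> Pf i j k; under eq_fun do rewrite !mxE scoord_conj.
exact: fun_algM PA _ _ (fun_alg_cst PA _) (Pf _ _ _).
Qed.

Lemma mx_in_rscale a f : mx_in f -> mx_in (fun t => rscale a (f t)).
Proof.
move=> Pf i j k; under eq_fun do rewrite mxE scoord_of_real.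
exact: fun_algM PA _ _ (fun_alg_cst PA _) (Pf _ _ _).
Qed.

Lemma mx_in_rotate f g : mx_in f -> mx_in g -> mx_in (fun t => rotate_mat (f t) (g t)).
Proof. by move=> Pf Pg; apply: mx_inM; [exact: mx_inM | exact: mx_in_adj]. Qed.
End fun_alg_scalars.

(** * Adjoints, rotations and orthogonal projections *)

Section matrices.
Variables (R : realType) (beta n : nat).
Implicit Types X Y U V : mat R beta n.

Lemma adjmxM X Y : adjmx_conj (X *m Y : mat R beta n) = adjmx_conj Y *m adjmx_conj X.
Proof.
apply/matrixP => i j; rewrite !mxE sconj_sum; apply: eq_bigr => k _.
by rewrite sconjM !mxE.
Qed.

Lemma adjmxK X : adjmx_conj (adjmx_conj X) = X.
Proof.
apply/matrixP => i j; rewrite !mxE; apply: scoord_inj => k.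
by rewrite !scoord_conj mulrA -expr2 sqrr_sign mul1r.
Qed.

Lemma adjmxD X Y : adjmx_conj (X + Y) = adjmx_conj X + adjmx_conj Y.
Proof. by apply/matrixP => i j; rewrite !mxE sconjD. Qed.

Lemma adjmx0 : adjmx_conj (0 : mat R beta n) = 0.
Proof. by apply/matrixP => i j; rewrite !mxE sconj0. Qed.

Lemma adjmx_sum (I : Type) (r : seq I) (Q : pred I) (f : I -> mat R beta n) :
  adjmx_conj (\sum_(i <- r | Q i) f i) = \sum_(i <- r | Q i) adjmx_conj (f i).
Proof. exact: (big_morph (@adjmx_conj R beta n) adjmxD adjmx0). Qed.

Lemma adj_pid_mx m : adjmx_conj (partial_id R beta n m) = partial_id R beta n m.
Proof.
apply/matrixP => i j; rewrite !mxE.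
have [->|] := eqVneq i j.
  by rewrite eqxx; case: (_ < _)%N; rewrite ?sconj1 ?sconj0.
rewrite eq_sym => /negbTE ij; rewrite -!val_eqE /= in ij *.
by rewrite ij eq_sym ij sconj0.
Qed.

Lemma adj_scalar1 : adjmx_conj (1%:M : mat R beta n) = 1%:M.
Proof.
by apply/matrixP => i j; rewrite !mxE eq_sym; case: (i == j); rewrite ?sconj1 ?sconj0.
Qed.

Lemma rotate_mulmx U V X :
  rotate_mat (U *m V : mat R beta n) X = rotate_mat U (rotate_mat V X).
Proof. by rewrite /rotate_mat adjmxM !mulmxA. Qed.

Lemma rotate_sum U (I : Type) (r : seq I) (Q : pred I) (f : I -> mat R beta n) :
  rotate_mat U (\sum_(i <- r | Q i) f i) = \sum_(i <- r | Q i) rotate_mat U (f i).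
Proof. by rewrite /rotate_mat mulmx_sumr mulmx_suml. Qed.

Definition projections : set (mat R beta n) :=
  [set E | adjmx_conj E = E /\ E *m E = E].

Lemma projection_rotate U X :
  unitary_mats U -> projections X -> projections (rotate_mat U X).
Proof.
move=> [_ U2] [X1 X2]; rewrite /rotate_mat; split.
  by rewrite !adjmxM adjmxK X1 !mulmxA.
rewrite -!mulmxA (mulmxA (adjmx_conj U)) U2 mul1mx.
by rewrite (mulmxA X) X2.
Qed.

Lemma projection_pid m : (m <= n)%N -> projections (partial_id R beta n m).
Proof. by move=> mn; split; [exact: adj_pid_mx | rewrite /partial_id pid_mx_id]. Qed.

Lemma projection0 : projections 0.
Proof. by split; [exact: adjmx0 | exact: mul0mx]. Qed.

Lemma projection1 : projections 1%:M.
Proof. by split; [exact: adj_scalar1 | exact: mul1mx]. Qed.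

(* The diagonal entry [c = E_ii] of a projection is the squared norm of its
   [i]-th row, so [c ^ 2 <= c] and every entry of the row has norm at most 1. *)
Lemma projection_coord_le1 E (i j : 'I_n) k : projections E -> `|scoord k (E i j)| <= 1.
Proof.
move=> [E1 E2]; have rowE : scoord 0 (E i i) = \sum_l scoord 0 (E i l * sconj (E i l)).
  rewrite -[in LHS]E2 mxE scoord_sum; apply: eq_bigr => l _.
  by rewrite -[in E l i]E1 !mxE.
have ge0 l : 0 <= scoord 0 (E i l * sconj (E i l)).
  exact: le_trans (sqr_ge0 _) (scoord_mul_conj_ge 0 _).
have le_diag l m : scoord m (E i l) ^+ 2 <= scoord 0 (E i i).
  apply: (le_trans (scoord_mul_conj_ge _ _)).
  by rewrite rowE (bigD1 l) //= lerDl sumr_ge0.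
move: (le_diag i 0%N) (le_diag j k); set c := scoord 0 _; set x := scoord k _ => c2 x2.
have c1 : c <= 1.
  rewrite leNgt; apply/negP => c1; move: c2; apply/negP.
  by rewrite -ltNge expr2 ltr_pMr // (lt_trans ltr01).
have x1 : `|x| ^+ 2 <= 1 by rewrite real_normK ?num_real //; exact: le_trans c1.
by rewrite expr_le1 in x1.
Qed.
End matrices.

(** * Measurable maps into matrices and measurable sets of matrices *)

Section measurability_of_matrices.
Variables (R : realType) (beta n : nat) (d : measure_display) (T : measurableType d).
Implicit Types f g : T -> mat R beta n.

Lemma fun_alg_measurable : fun_alg (fun f : T -> R => measurable_fun setT f).
Proof.
split; first by move=> a; exact: measurable_cst.
  exact: measurable_funD.
exact: measurable_funM.
Qed.

Lemma measurable_mxP f :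
  measurable_fun setT f <-> mx_in (fun u => measurable_fun setT u) f.
Proof.
split=> [mf i j k _ B mB|mf].
  have := mf measurableT ((fun X : mat R beta n => scoord k (X i j)) @^-1` B).
  rewrite !setTI; apply; apply: sub_sigma_algebra.
  by exists i, j, k, B.
apply: (measurability (@mat_cylinder R beta n)) => // _ [_ [i [j [k [B [mB ->]]]]] <-].
exact: mf.
Qed.

Lemma measurable_forall_entries (Q : 'I_n -> 'I_n -> nat -> T -> Prop) :
  (forall i j k, measurable [set t | Q i j k t]) ->
  measurable [set t | forall i j k, Q i j k t].
Proof.
move=> mQ; rewrite (_ : mkset _ = \bigcap_i \bigcap_j \bigcap_k [set t | Q i j k t]).
  apply: fin_bigcap_measurable => [|i _]; first exact: finite_finset.
  apply: fin_bigcap_measurable => [|j _]; first exact: finite_finset.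
  exact: bigcapT_measurable.
apply/seteqP; split=> [t Qt i _ j _ k _|t Qt i j k]; first exact: Qt.
exact: Qt.
Qed.

Lemma measurable_mx_eq f g : measurable_fun setT f -> measurable_fun setT g ->
  measurable [set t | f t = g t].
Proof.
move=> /measurable_mxP mf /measurable_mxP mg.
rewrite (_ : mkset _ = [set t | forall i j k, scoord k (f t i j) = scoord k (g t i j)]).
  apply: measurable_forall_entries => i j k.
  have := measurable_fun_eqr (mf i j k) (mg i j k) measurableT (Y := [set true]).
  rewrite setTI (_ : _ @^-1` _ = [set t | scoord k (f t i j) = scoord k (g t i j)]).
    exact.
  by apply/seteqP; split=> t /= /eqP.
apply/seteqP; split=> [t /= -> //|t /= fg].
by apply/matrixP => i j; apply: scoord_inj => k; exact: fg.
Qed.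
End measurability_of_matrices.

Section measurable_sets_of_matrices.
Variables (R : realType) (beta n : nat).

Lemma measurable_adjmx : measurable_fun setT (@adjmx_conj R beta n).
Proof.
apply/measurable_mxP; apply: mx_in_adj; first exact: fun_alg_measurable.
exact/measurable_mxP.
Qed.

Lemma measurable_herm : measurable (@herm_mats R beta n).
Proof. by apply: measurable_mx_eq; [exact: measurable_adjmx|]. Qed.

Lemma measurable_projections : measurable (@projections R beta n).
Proof.
apply: measurableI; first exact: measurable_herm.
apply: measurable_mx_eq => //; apply/measurable_mxP.
by apply: mx_inM; [exact: fun_alg_measurable| |]; apply/measurable_mxP.
Qed.

Lemma measurable_unitary : measurable (@unitary_mats R beta n).
Proof.
by apply: measurableI; apply: measurable_mx_eq => //; apply/measurable_mxP;
  apply: mx_inM; try exact: fun_alg_measurable; apply/measurable_mxP => //;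
  exact: measurable_adjmx.
Qed.

Lemma measurable_rotate U : measurable_fun setT (@rotate_mat R beta n U).
Proof.
apply/measurable_mxP; apply: mx_in_rotate; [exact: fun_alg_measurable| |].
  by apply: mx_in_cst; exact: fun_alg_measurable.
exact/measurable_mxP.
Qed.

Lemma measurable_orbit X : measurable_fun setT (fun U : mat R beta n => rotate_mat U X).
Proof.
apply/measurable_mxP; apply: mx_in_rotate; [exact: fun_alg_measurable| |].
  exact/measurable_mxP.
by apply: mx_in_cst; exact: fun_alg_measurable.
Qed.

Definition bounded_mats (M : R) : set (mat R beta n) :=
  [set X | forall i j k, `|scoord k (X i j)| <= M].

Lemma measurable_bounded_mats M : measurable (bounded_mats M).
Proof.
apply: measurable_forall_entries => i j k.
have mX : measurable_fun setT (fun X : mat R beta n => `|scoord k (X i j)|).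
  by apply: measurableT_comp => //; exact: (measurable_mxP (@id (mat R beta n))).1.
have := mX measurableT [set x | x <= M]; rewrite setTI; apply.
by rewrite -set_itvNyc.
Qed.

Lemma bounded_sum_projections (I : finType) (E : I -> mat R beta n) :
  (forall i, projections (E i)) -> bounded_mats #|I|%:R (\sum_i E i).
Proof.
move=> PE i j k; rewrite summxE scoord_sum (le_trans (ler_norm_sum _ _ _)) //.
rewrite -sum1_card natr_sum ler_sum // => l _; exact: projection_coord_le1.
Qed.
End measurable_sets_of_matrices.

(** * Integrability from almost sure boundedness *)

Section almost_surely_bounded.
Variables (R : realType) (d : measure_display) (T : measurableType d).
Variables (P : probability T R) (G : set T).
Hypotheses (mG : measurable G) (PG : P G = 1%E).

(** The bound is asked only on the event [G] of probability 1, since the random matrices are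
    projections only almost surely; measurability is asked everywhere. *)
Definition bounded_on (f : T -> R) :=
  measurable_fun setT f /\ exists M, forall t, G t -> `|f t| <= M.

Lemma fun_alg_bounded_on : fun_alg bounded_on.
Proof.
split.
- by move=> a; split; [exact: measurable_cst | exists `|a|].
- move=> f g [mf [M fM]] [mg [M' gM']]; split; first exact: measurable_funD.
  by exists (M + M') => t Gt; rewrite (le_trans (ler_normD _ _)) // lerD ?fM ?gM'.
- move=> f g [mf [M fM]] [mg [M' gM']]; split; first exact: measurable_funM.
  by exists (M * M') => t Gt; rewrite normrM ler_pM ?fM ?gM'.
Qed.

Lemma probability_setC0 : P (~` G) = 0%E.
Proof. by rewrite probability_setC // PG subee. Qed.

Lemma bounded_on_integrable f : bounded_on f -> P.-integrable setT (EFin \o f).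
Proof.
move=> [mf [M fM]].
apply/(negligible_integrable (measurableC mG)) => //; first exact/measurable_EFinP.
  exact: probability_setC0.
rewrite setTD setCK; apply: measurable_bounded_integrable => //.
- exact: le_lt_trans (probability_le1 P mG) (ltry 1).
- exact: measurable_funTS.
- exists M; split; first exact: num_real.
  by move=> x Mx t Gt; rewrite /= (le_trans (fM _ Gt)) // ltW.
Qed.

Lemma bounded_on_indic d' (U : measurableType d') (f : T -> U) (A : set U) :
  measurable A -> measurable_fun setT f -> bounded_on (fun t => \1_A (f t)).
Proof.
move=> mA mf; have mA1 : measurable_fun setT (\1_A : U -> R) by exact: measurable_indic.
split; first exact: measurableT_comp mA1 mf.
by exists 1 => t _; rewrite indicE ger0_norm // lern1 leq_b1.
Qed.

Lemma mx_in_bounded_on beta n M (f : T -> mat R beta n) : measurable_fun setT f ->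
  (forall t, G t -> bounded_mats M (f t)) -> mx_in bounded_on f.
Proof.
move=> /measurable_mxP mf fM i j k; split; first exact: mf.
by exists M => t Gt; exact: fM.
Qed.
End almost_surely_bounded.

(** * Finite i.i.d. families, their joint law and exchangeability *)

Section families.
Variables (I : finType) (d' : measure_display) (T : measurableType d').

Definition rectangles : set (set (I -> T)) :=
  [set B | exists2 A : I -> set T, forall i, measurable (A i) &
     B = [set x | forall i, A i (x i)]].

(** The product sigma-algebra on [I -> T]; with families as functions, permuting the variables is a
    mere precomposition. *)
Definition family_space := g_sigma_algebraType rectangles.

Lemma measurable_family_coord i : measurable_fun setT (fun x : family_space => x i).
Proof.
move=> _ B mB; rewrite setTI; apply: sub_sigma_algebra.
exists (fun j => if j == i then B else setT) => [j|]; first by case: ifP.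
apply/seteqP; split=> x /=; first by move=> Bx j; case: eqP => // ->.
by move=> /(_ i); rewrite eqxx.
Qed.

Lemma measurable_family (d : measure_display) (Omega : measurableType d)
    (F : Omega -> family_space) :
  (forall i, measurable_fun setT (fun w => F w i)) -> measurable_fun setT F.
Proof.
move=> mF; apply: (@measurability _ _ Omega family_space setT F rectangles) => //.
move=> _ [_ [A mA ->] <-].
rewrite setTI (_ : _ @^-1` _ = \bigcap_i ((fun w => F w i) @^-1` A i)).
  apply: fin_bigcap_measurable => [|i _]; first exact: finite_finset.
  by have := mF i measurableT _ (mA i); rewrite setTI.
by apply/seteqP; split=> [w Fw i _|w Fw i]; exact: Fw.
Qed.

Variables (R : realType) (nu : set T -> \bar R).

(** Independence and common law in one product formula over the whole index set. [nu] is only a set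
    function, so that [bernoulli_ensemble] can be used before anything is proved about it. *)
Definition iid (d : measure_display) (Omega : measurableType d)
    (P : probability Omega R) (F : Omega -> family_space) : Prop :=
  (forall i, measurable_fun setT (fun w => F w i)) /\
  forall A : I -> set T, (forall i, measurable (A i)) ->
    P [set w | forall i, A i (F w i)] = (\prod_i nu (A i))%E.

Section comparison.
Variables (d1 d2 : measure_display).
Variables (Omega1 : measurableType d1) (Omega2 : measurableType d2).
Variables (P1 : probability Omega1 R) (P2 : probability Omega2 R).
Variables (F1 : Omega1 -> family_space) (F2 : Omega2 -> family_space).
Hypotheses (iid1 : iid P1 F1) (iid2 : iid P2 F2).

Let mF1 := isMeasurableFun.Build _ _ _ _ F1 (measurable_family iid1.1).
Let mF2 := isMeasurableFun.Build _ _ _ _ F2 (measurable_family iid2.1).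
Let G1 : {mfun Omega1 >-> family_space} := HB.pack F1 mF1.
Let G2 : {mfun Omega2 >-> family_space} := HB.pack F2 mF2.

(** Rectangles form a pi-system generating the sigma-algebra, so the product formula determines the
    joint law. *)
Lemma iid_same_law (B : set family_space) : measurable B ->
  P1 (F1 @^-1` B) = P2 (F2 @^-1` B).
Proof.
move=> mB; rewrite -[LHS]/(distribution P1 G1 B) -[RHS]/(distribution P2 G2 B).
apply: (@measure_unique _ R family_space rectangles (fun=> setT) _ _ _ _
  (distribution P1 G1) (distribution P2 G2)) => //.
- move=> _ _ [A mA ->] [A' mA' ->]; exists (fun i => A i `&` A' i).
    by move=> i; exact: measurableI.
  by apply/seteqP; split=> [x [Ax Ax'] i //|x Ax]; split=> i; have [] := Ax i.
- by move=> _; exists (fun=> setT) => //; apply/seteqP; split.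
- by rewrite bigcup_const.
- by move=> _ [A mA ->]; rewrite [LHS](iid1.2 _ mA) [RHS](iid2.2 _ mA).
- by move=> _; rewrite -ge0_fin_numE ?fin_num_measure.
Qed.

Lemma iid_same_integral (phi : family_space -> R) : measurable_fun setT phi ->
  P1.-integrable setT (EFin \o (phi \o F1)) ->
  P2.-integrable setT (EFin \o (phi \o F2)) ->
  (\int[P1]_w (phi (F1 w))%:E = \int[P2]_w (phi (F2 w))%:E)%E.
Proof.
move=> mphi int1 int2; have mphiE := proj2 (measurable_EFinP _ _) mphi.
have <- := @integral_distribution _ _ _ _ _ P1 G1 _ mphiE int1.
have <- := @integral_distribution _ _ _ _ _ P2 G2 _ mphiE int2.
by apply: eq_measure_integral => A mA _; exact: iid_same_law.
Qed.
End comparison.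

Lemma iid_perm (d : measure_display) (Omega : measurableType d)
    (P : probability Omega R) (F : Omega -> family_space) (s : {perm I}) :
  iid P F -> iid P (fun w i => F w (s i)).
Proof.
move=> [mF iF]; split=> [i|A mA]; first exact: mF.
rewrite (_ : mkset _ = [set w | forall i, A (s^-1%g i) (F w i)]); last first.
  apply/seteqP; split=> w /= Aw i; first by have := Aw (s^-1%g i); rewrite permKV.
  by have := Aw (s i); rewrite permK.
rewrite (iF (fun i => A (s^-1%g i))) // (reindex_inj (@perm_inj _ s)) /=.
by apply: eq_bigr => i _; rewrite permK.
Qed.
End families.
Arguments family_space I {d'} T.

(** * Real multiples of matrices and squares of weighted sums *)

Section real_scaling.
Variables (R : realType) (beta n : nat).
Implicit Types X Y : mat R beta n.

(** Real scalars are central even in the quaternions; this is what lets weights leave a matrix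
    product. *)
Lemma of_realC a (x : dscalar R beta) : of_real beta a * x = x * of_real beta a.
Proof.
case: beta x => [|[|[|b]]] /= x.
- by apply: quatP => /=; ring.
- by rewrite mulrC.
- exact: (@mulrC R[i]).
- by apply: quatP => /=; ring.
Qed.

Lemma of_realM (a b : R) : of_real beta (a * b) = of_real beta a * of_real beta b.
Proof.
apply: scoord_inj => k; rewrite scoord_of_real -[of_real beta (a * b)]mulr1.
by rewrite -[of_real beta b]mulr1 !scoord_of_real mulrA.
Qed.

Lemma rscaleM a b X Y :
  (rscale a X *m rscale b Y : mat R beta n) = rscale (a * b) (X *m Y).
Proof.
apply/matrixP => i j; rewrite !mxE mulr_sumr; apply: eq_bigr => l _.
by rewrite !mxE of_realM -!mulrA; congr (_ * _); rewrite !mulrA of_realC.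
Qed.

Lemma scoord_rscale a X i j k : scoord k (rscale a X i j) = a * scoord k (X i j).
Proof. by rewrite mxE scoord_of_real. Qed.

Lemma rscale1 X : rscale 1 X = X.
Proof.
by apply/matrixP => i j; apply: scoord_inj => k; rewrite scoord_rscale mul1r.
Qed.

Lemma rscaleN1 X : rscale (-1) X = - X.
Proof.
apply/matrixP => i j; apply: scoord_inj => k.
by rewrite scoord_rscale mxE scoordN mulN1r.
Qed.

Lemma scoord_sqr_sum (I : finType) (c : I -> R) (X : I -> mat R beta n) i j k :
  let Z : mat R beta n := \sum_p rscale (c p) (X p) in
  scoord k ((Z *m Z) i j) =
  \sum_p \sum_p' c p * c p' * scoord k ((X p *m X p') i j).
Proof.
rewrite /= mulmx_suml summxE scoord_sum; apply: eq_bigr => p _.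
rewrite mulmx_sumr summxE scoord_sum; apply: eq_bigr => p' _.
by rewrite -scoord_rscale -rscaleM.
Qed.
End real_scaling.

Section weights.
Variables (R : realType) (I : finType) (e : I -> I -> R) (e0 : R).
Hypothesis off_diag : forall p p', p != p' -> e p p' = e0.

(** The weights of the off-diagonal pairs add up to the square of the sum minus the sum of the
    squares. *)
Lemma weighted_double_sum (c : I -> R) :
  \sum_p \sum_p' c p * c p' * e p p' =
  \sum_p c p ^+ 2 * e p p + e0 * ((\sum_p c p) ^+ 2 - \sum_p c p ^+ 2).
Proof.
(* The diagonal is first given the value [e0] too, and its true value is restored by the correction
   [e p p - e0]. *)
transitivity (\sum_p (c p ^+ 2 * (e p p - e0) + c p * e0 * \sum_p' c p')).
  apply: eq_bigr => p _; rewrite [in RHS](bigD1 p) //= (bigD1 p) //=.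
  rewrite (eq_bigr (fun p' => c p * e0 * c p')) -?mulr_sumr; first by ring.
  by move=> p' pp'; rewrite off_diag 1?eq_sym //; ring.
rewrite big_split /= -mulr_suml -mulr_suml.
under eq_bigr do rewrite mulrBr.
by rewrite sumrB -mulr_suml; ring.
Qed.
End weights.

Lemma perm_pair (I : finType) (a b a' b' : I) : a != b -> a' != b' ->
  exists s : {perm I}, s a = a' /\ s b = b'.
Proof.
(* The first transposition sends [a] to [a']; the second sends the image of [b] to [b'] and fixes
   [a'], which differs from both. *)
move=> ab ab'; exists (tperm a a' * tperm (tperm a a' b) b')%g.
rewrite !permM tpermL tpermL tpermD // 1?eq_sym //.
by rewrite -{1}(tpermL a a') (inj_eq perm_inj).
Qed.

(** * Mean products of i.i.d. projections restricted to an event of their sum *)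

Section iid_projections.
Variables (R : realType) (beta n : nat) (I : finType).
Local Notation mat := (mat R beta n).
Variables (nu : set mat -> \bar R) (nuQ : nu (@projections R beta n) = 1%E).
Variables (d : measure_display) (Omega : measurableType d) (P : probability Omega R).
Variables (F : Omega -> family_space I mat) (iidF : iid nu P F).

Definition all_projections := [set w | forall p, projections (F w p : mat)].
Local Notation G := all_projections.

Lemma measurable_all_projections : measurable G.
Proof.
rewrite (_ : G = \bigcap_p ((fun w => F w p) @^-1` (@projections R beta n))).
  apply: fin_bigcap_measurable => [|p _]; first exact: finite_finset.
  by have := iidF.1 p measurableT _ (@measurable_projections R beta n); rewrite setTI.
by apply/seteqP; split=> [w Fw i _|w Fw i]; exact: Fw.
Qed.

Lemma all_projections_as : P G = 1%E.
Proof.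
rewrite [LHS](iidF.2 (fun=> @projections R beta n)) ?big1 // => _.
exact: measurable_projections.
Qed.

Local Notation bdd := (@bounded_on R _ _ G).
Let bddA : fun_alg bdd := fun_alg_bounded_on R G.
Let integrable_bdd f (bf : bdd f) :=
  bounded_on_integrable measurable_all_projections all_projections_as bf.

Lemma bounded_iid p : mx_in bdd (fun w => F w p : mat).
Proof.
apply: (mx_in_bounded_on (M := 1)); first exact: iidF.1.
by move=> w Gw i j k; apply: projection_coord_le1; exact: Gw.
Qed.

Variables (A : set mat) (mA : measurable A).
Definition matrix_total w : mat := \sum_p F w p.
(** Equality of these numbers for every measurable [A] is equality of conditional expectations given
    the sum. The indicator is put in the integrand so that the whole is a function of the family, to
    which equality of laws applies. *)
Definition restricted_mean (f : Omega -> R) := \int[P]_w (\1_A (matrix_total w) * f w).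
Local Notation J := restricted_mean.

Lemma measurable_total : measurable_fun setT matrix_total.
Proof.
apply/measurable_mxP; apply: mx_in_sum; first exact: fun_alg_measurable.
by move=> p; apply/measurable_mxP; exact: iidF.1.
Qed.

Lemma bounded_restriction (f : Omega -> R) :
  bdd f -> bdd (fun w => \1_A (matrix_total w) * f w).
Proof.
apply: (fun_algM bddA (f := fun w => \1_A (matrix_total w))).
exact: bounded_on_indic measurable_total.
Qed.

Lemma restricted_meanD f g : bdd f -> bdd g -> J (fun w => f w + g w) = J f + J g.
Proof.
move=> bf bg; rewrite /J; under eq_Rintegral do rewrite mulrDr.
by apply: RintegralD => //; apply: integrable_bdd; exact: bounded_restriction.
Qed.

Lemma restricted_meanZ a f : bdd f -> J (fun w => a * f w) = a * J f.
Proof.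
move=> bf; rewrite /J; under eq_Rintegral do rewrite mulrCA.
by apply: RintegralZl => //; apply: integrable_bdd; exact: bounded_restriction.
Qed.

Lemma restricted_mean_sum (K : Type) (r : seq K) (f : K -> Omega -> R) :
  (forall i, bdd (f i)) -> J (fun w => \sum_(i <- r) f i w) = \sum_(i <- r) J (f i).
Proof.
move=> bf; elim: r => [|i r IH].
  rewrite big_nil /J; under eq_Rintegral do rewrite big_nil mulr0.
  by rewrite Rintegral_cst // mul0r.
rewrite big_cons -IH -restricted_meanD //; last exact: fun_alg_sum.
by congr J; apply/funext => w; rewrite big_cons.
Qed.

Variables (i j : 'I_n) (k : nat).
Definition pair_mean p p' := J (fun w => scoord k ((F w p *m F w p' : mat) i j)).

Lemma bounded_pair p p' : bdd (fun w => scoord k ((F w p *m F w p' : mat) i j)).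
Proof. by apply: (mx_inM bddA); exact: bounded_iid. Qed.

(** Idempotence holds on the almost sure event [G] only, so the integrands agree almost
    everywhere. *)
Lemma pair_mean_diag p : pair_mean p p = J (fun w => scoord k ((F w p : mat) i j)).
Proof.
rewrite /pair_mean /J /Rintegral; congr fine; apply: ae_eq_integral => //.
- exact: measurable_int (integrable_bdd (bounded_restriction (bounded_pair p p))).
- exact: measurable_int (integrable_bdd (bounded_restriction (@bounded_iid p i j k))).
exists (~` G); split.
- exact: measurableC measurable_all_projections.
- exact: probability_setC0 measurable_all_projections all_projections_as.
- by apply: subsetC => w Gw _; rewrite (Gw p).2.
Qed.

Let measurable_indicA : measurable_fun setT (\1_A : mat -> R).
Proof. exact: measurable_indic. Qed.

(** A permutation of the indices preserves the joint law and leaves the sum, hence the indicator,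
    unchanged; only the pair of factors moves. *)
Lemma pair_mean_exchangeable a b a' b' : a != b -> a' != b' ->
  pair_mean a b = pair_mean a' b'.
Proof.
move=> ab ab'; have [s [sa sb]] := perm_pair ab ab'.
pose phi (x : family_space I mat) : R :=
  \1_A (\sum_p x p) * scoord k ((x a *m x b : mat) i j).
have mx p : mx_in (fun u => measurable_fun setT u)
    (fun x : family_space I mat => x p : mat).
  by apply/measurable_mxP; exact: measurable_family_coord.
have mphi : measurable_fun setT phi.
  apply: measurable_funM.
    apply: (measurableT_comp measurable_indicA
      (g := fun x : family_space I mat => \sum_p x p)).
    by apply/measurable_mxP; apply: mx_in_sum => //; exact: fun_alg_measurable.
  by apply: (mx_inM (fun_alg_measurable _ _)).
have := iid_same_integral iidF (iid_perm s iidF) mphi.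
have -> : phi \o (fun w p => F w (s p)) =
    (fun w => \1_A (matrix_total w) * scoord k ((F w a' *m F w b' : mat) i j)).
  apply/funext => w; rewrite /phi /= sa sb; congr (\1_A _ * _).
  by rewrite /matrix_total [RHS](reindex_inj (@perm_inj _ s)).
move=> eq_int; rewrite /pair_mean /J /Rintegral; congr fine; rewrite eq_int.
- apply: eq_integral => w _; rewrite /phi /= sa sb /matrix_total.
  by rewrite [in RHS](reindex_inj (@perm_inj _ s)).
- exact: integrable_bdd (bounded_restriction (bounded_pair a b)).
- exact: integrable_bdd (bounded_restriction (bounded_pair a' b')).
Qed.

(** Constant weights 1 give [S], and signs give the difference of the two groups. *)
Definition weighted_total (c : I -> R) w : mat := \sum_p rscale (c p) (F w p).

Lemma restricted_mean_sqr a b c : a != b ->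
  J (fun w => scoord k ((weighted_total c w *m weighted_total c w : mat) i j)) =
  \sum_p c p ^+ 2 * J (fun w => scoord k ((F w p : mat) i j)) +
  pair_mean a b * ((\sum_p c p) ^+ 2 - \sum_p c p ^+ 2).
Proof.
move=> ab; under eq_bigr do rewrite -pair_mean_diag.
rewrite -weighted_double_sum; last by move=> p p' pp'; exact: pair_mean_exchangeable.
transitivity (J (fun w => \sum_p \sum_p'
    c p * c p' * scoord k ((F w p *m F w p' : mat) i j))).
  by congr J; apply/funext => w; exact: scoord_sqr_sum.
have bp p p' : bdd (fun w => c p * c p' * scoord k ((F w p *m F w p' : mat) i j)).
  by apply: (fun_algM bddA (fun_alg_cst bddA _)); exact: bounded_pair.
rewrite restricted_mean_sum => [|p]; last exact: fun_alg_sum.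
apply: eq_bigr => p _; rewrite restricted_mean_sum //.
by apply: eq_bigr => p' _; rewrite restricted_meanZ //; exact: bounded_pair.
Qed.
End iid_projections.

Lemma probability1S (R : realType) (d : measure_display) (T : measurableType d)
    (P : probability T R) (A B : set T) :
  measurable A -> measurable B -> A `<=` B -> P A = 1%E -> P B = 1%E.
Proof.
move=> mA mB AB PA; apply/eqP; rewrite eq_le probability_le1 //= -PA.
by apply: le_measure => //; rewrite inE.
Qed.

(** * The quadratic identity for two groups of projections *)

Section signs.
Variables (R : realType) (N : nat).
Local Notation I := (bool * 'I_N)%type.

(** The boolean names the group: [false] for the summands of [X], [true] for those of [Y]. *)
Definition copy_sign (p : I) : R := (-1) ^+ p.1.

Lemma sum_copy_sign : \sum_p copy_sign p = 0.
Proof.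
rewrite (eq_bigr (fun p : I => (fun b i => copy_sign (b, i)) p.1 p.2)) => [|[]//].
rewrite -(pair_bigA _ (fun b i => copy_sign (b, i))) big_bool /= -big_split.
by apply: big1 => i _; rewrite /= /copy_sign /= expr1 expr0 addNr.
Qed.

Lemma sum_copy_sign_sqr : \sum_p copy_sign p ^+ 2 = 2 * N%:R :> R.
Proof.
under eq_bigr do rewrite /copy_sign sqrr_sign.
by rewrite sumr_const card_prod card_bool card_ord natrM.
Qed.
End signs.

Section two_copies.
Variables (R : realType) (beta n N : nat) (N_ge1 : (1 <= N)%N).
Local Notation mat := (mat R beta n).
Local Notation I := (bool * 'I_N)%type.
Variables (nu : set mat -> \bar R) (nuQ : nu (@projections R beta n) = 1%E).
Variables (d : measure_display) (Omega : measurableType d) (P : probability Omega R).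
Variables (F : Omega -> family_space I mat) (iidF : iid nu P F).
Variables (A : set mat) (mA : measurable A) (i j : 'I_n) (k : nat).
Local Notation S := (matrix_total F).
Local Notation D := (weighted_total F (@copy_sign R N)).
Local Notation J := (restricted_mean P F A).
Local Notation bdd := (@bounded_on R _ _ (all_projections F)).

Let bddA : fun_alg bdd := fun_alg_bounded_on R (all_projections F).
Let bF := bounded_iid iidF.

Lemma bounded_total : mx_in bdd S.
Proof. exact: mx_in_sum. Qed.

(** The zero constant term is kept so that this unfolds to the expression in [is_meixner]. *)
Definition meixner_quadratic (X : mat) : mat :=
  rscale (- (1 / (2 * N%:R - 1))) (X *m X) + rscale (2 * N%:R / (2 * N%:R - 1)) X
  + rscale 0 1%:M.

Lemma two_copies_meixner :
  J (fun w => scoord k (meixner_quadratic (S w) i j)) =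
  J (fun w => scoord k ((D w *m D w : mat) i j)).
Proof.
have card_I : \sum_(p : I) (1 : R) = 2 * N%:R.
  by rewrite sumr_const card_prod card_bool card_ord natrM.
have [a [b ab]] : exists a b : I, a != b.
  by exists (true, Ordinal N_ge1), (false, Ordinal N_ge1).
have SE : S = weighted_total F (fun=> 1).
  by apply/funext => w; apply: eq_bigr => p _; rewrite rscale1.
have bS2 : mx_in bdd (fun w => S w *m S w : mat).
  by apply: mx_inM => //; exact: bounded_total.
have Zb c f : bdd f -> bdd (fun w => c * f w).
  by move=> bf; apply: (fun_algM bddA) => //; exact: fun_alg_cst.
transitivity (- (1 / (2 * N%:R - 1)) * J (fun w => scoord k ((S w *m S w : mat) i j)) +
   2 * N%:R / (2 * N%:R - 1) * J (fun w => scoord k (S w i j))).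
  rewrite -!(restricted_meanZ nuQ iidF mA) //; last exact: bounded_total.
  rewrite -(restricted_meanD nuQ iidF mA); last 2 first.
  - exact/Zb/bS2.
  - exact/Zb/bounded_total.
  congr J; apply/funext => w; rewrite /meixner_quadratic mxE scoordD mxE scoordD.
  by rewrite !scoord_rscale mul0r addr0.
have -> : J (fun w => scoord k (S w i j)) =
    \sum_p J (fun w => scoord k ((F w p : mat) i j)).
  rewrite -(restricted_mean_sum nuQ iidF mA) => [|p]; last exact: bF.
  by congr J; apply/funext => w; rewrite summxE scoord_sum.
rewrite SE !(restricted_mean_sqr nuQ iidF mA i j k _ ab).
rewrite sum_copy_sign sum_copy_sign_sqr.
under [X in X + pair_mean _ _ _ _ _ _ _ _ * (_ - _)]eq_bigr do rewrite expr1n mul1r.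
under [X in _ = X + _]eq_bigr do rewrite sqrr_sign mul1r.
under [X in _ - X]eq_bigr do rewrite expr1n.
(* Let T be the sum of the means of the [F_p] and K the off-diagonal mean. The Meixner parameters A
   and B must satisfy [A (T + 2N(2N-1) K) + B T = T - 2N K]: the coefficient of K forces
   [A = -1/(2N-1)], and that of T then forces [B = 1 - A = 2N/(2N-1)]. *)
rewrite card_I; field.
have : 1 <= N%:R :> R by rewrite ler1n.
by move=> N1; apply/eqP => N0; lra.
Qed.
End two_copies.

(** * Support and rotation invariance of the Bernoulli ensemble *)

Section bernoulli.
Variables (R : realType) (beta n : nat) (n_ge1 : (1 <= n)%N).
Local Notation mat := (mat R beta n).
Variables (h : probability mat R) (h_haar : is_haar h) (q : nat -> R).
Local Notation nu := (bernoulli_ensemble h q).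

(** The weights add up to 1, and each component is carried by projections because Haar measure is
    carried by the unitary matrices. *)
Lemma bernoulli_projections : nu (@projections R beta n) = 1%E.
Proof.
rewrite /bernoulli_ensemble !diracE !mem_set; [|exact: projection1|exact: projection0].
rewrite (eq_big_nat _ _ (F2 := fun m => (q m)%:E)) => [|m /andP[_ mn]].
  rewrite sumEFin !mule1 -!EFinD (big_nat_recr _ _ _ n_ge1) /=; congr EFin; ring.
rewrite [projection_law _ _ _](_ : _ = 1%E) ?mule1 //.
have mQ := @measurable_projections R beta n.
have := measurable_orbit (partial_id R beta n m) measurableT mQ; rewrite setTI => mQ'.
apply: (probability1S (@measurable_unitary R beta n) mQ' _ h_haar.1) => U uU.
by apply: projection_rotate => //; exact/projection_pid/ltnW.
Qed.

(** Rotations fix 0 and the identity; on the other components, rotating by [V] replaces [U] by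
    [V *m U], which left invariance of Haar measure absorbs. *)
Lemma bernoulli_rotation V A : unitary_mats V -> measurable A ->
  nu (rotate_mat V @^-1` A) = nu A.
Proof.
move=> uV mA; rewrite /bernoulli_ensemble.
have dirac_rotate (X : mat) : rotate_mat V X = X ->
    \d_X (rotate_mat V @^-1` A) = \d_X A :> \bar R.
  move=> VX; rewrite !diracE (_ : (X \in _ @^-1` _) = (X \in A)) //.
  by apply/idP/idP; rewrite !inE /= VX.
rewrite !dirac_rotate; last 2 first.
- by rewrite /rotate_mat mulmx1; exact: uV.1.
- by rewrite /rotate_mat mulmx0 mul0mx.
congr (_ + _ + _)%E; apply: eq_bigr => m _; congr (_ * _)%E.
have mB := measurable_orbit (partial_id R beta n m) measurableT mA.
rewrite setTI in mB; rewrite /projection_law /pushforward -[RHS](h_haar.2 _ uV _ mB).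
by congr (h _); apply/funext => U /=; rewrite rotate_mulmx.
Qed.
End bernoulli.

(** * The binomial ensemble and its realization by two copies *)

Section binomial.
Variables (R : realType) (beta n N : nat) (n_ge1 : (1 <= n)%N) (N_ge1 : (1 <= N)%N).
Local Notation mat := (mat R beta n).
Variables (h : probability mat R) (h_haar : is_haar h) (q : nat -> R).
Local Notation nu := (bernoulli_ensemble h q).
Variables (d : measure_display) (Omega : measurableType d) (P : probability Omega R).
Variables (E : 'I_N -> {RV P >-> mat}).
Hypotheses (indepE : mutually_independent E) (lawE : forall i, has_law (E i) nu).
Variables (mu : probability mat R).
Hypothesis muE : forall A, measurable A ->
  mu A = pushforward P (fun w => \sum_(i < N) E i w) A.

Let F : Omega -> family_space 'I_N mat := fun w i => E i w.

Lemma iid_binomial : iid nu P F.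
Proof.
split=> [i|A mA]; first exact: measurable_funPT.
transitivity (P (\bigcap_(i in [set` [set: 'I_N]%SET]) (E i @^-1` A i))).
  congr (P _); apply/seteqP; split=> [w Aw i _|w Aw i]; first exact: Aw.
  by apply: (Aw i); rewrite /= inE.
rewrite indepE //; apply: eq_big => [i|i _]; first by rewrite inE.
exact: lawE.
Qed.

Let nuQ := bernoulli_projections n_ge1 h_haar q.
Let mG := measurable_all_projections iid_binomial.
Let PG := all_projections_as nuQ iid_binomial.

Let m_sum (I : finType) :
  measurable_fun setT (fun x : family_space I mat => \sum_i x i : mat).
Proof.
apply/measurable_mxP; apply: mx_in_sum; first exact: fun_alg_measurable.
by move=> i; apply/measurable_mxP; exact: measurable_family_coord.
Qed.

Lemma binomial_as (B : set mat) : measurable B ->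
  (forall e : 'I_N -> mat, (forall i, projections (e i)) -> B (\sum_i e i)) ->
  mu B = 1%E.
Proof.
move=> mB QB; rewrite muE // /pushforward.
have mS : measurable_fun setT (fun w => \sum_(i < N) E i w : mat).
  exact: (measurable_total iid_binomial).
apply: (probability1S mG _ _ PG); last by move=> w Gw; exact: QB.
by rewrite -[X in measurable X]setTI; exact: mS.
Qed.

Lemma binomial_herm : mu (@herm_mats R beta n) = 1%E.
Proof.
apply: binomial_as => [|e Qe]; first exact: measurable_herm.
by rewrite /herm_mats /= adjmx_sum; apply: eq_bigr => i _; rewrite (Qe i).1.
Qed.

(** Boundedness becomes a property of the law [mu], and so passes to any [X] and [Y] with that
    law. *)
Lemma binomial_bounded : mu (@bounded_mats R beta n N%:R) = 1%E.
Proof.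
apply: binomial_as => [|e Qe]; first exact: measurable_bounded_mats.
by have := bounded_sum_projections Qe; rewrite card_ord.
Qed.

(** Rotating the sum rotates each summand, and the rotated summands are again i.i.d. with law
    [nu]. *)
Lemma binomial_rotation : rotation_invariant mu.
Proof.
move=> U uU A mA.
have mUA : measurable (rotate_mat U @^-1` A).
  by rewrite -[X in measurable X]setTI; exact: measurable_rotate.
rewrite !muE // /pushforward.
have iidU : iid nu P (fun w i => rotate_mat U (F w i)).
  split=> [i|B mB].
    exact: measurableT_comp (measurable_rotate U) (iid_binomial.1 i).
  have mUB i : measurable (rotate_mat U @^-1` B i).
    by rewrite -[X in measurable X]setTI; exact: measurable_rotate.
  rewrite [LHS](iid_binomial.2 _ mUB).
  by apply: eq_bigr => i _; exact: bernoulli_rotation.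
pose sum_mx (x : family_space 'I_N mat) : mat := \sum_i x i.
have mB : measurable (sum_mx @^-1` A).
  by rewrite -[X in measurable X]setTI; exact: m_sum.
transitivity (P ((fun w i => rotate_mat U (F w i)) @^-1` (sum_mx @^-1` A))).
  by congr (P _); apply/funext => w /=; rewrite rotate_sum.
by rewrite -(iid_same_law iid_binomial iidU mB).
Qed.

Lemma binomial_second_moments : finite_second_moments mu.
Proof.
move=> i j k.
have mB := @measurable_bounded_mats R beta n N%:R.
have bX : mx_in (@bounded_on R _ _ (@bounded_mats R beta n N%:R)) (fun X : mat => X).
  exact: (mx_in_bounded_on (M := N%:R)).
have /integrable_lty := bounded_on_integrable mB binomial_bounded
  (fun_algM (fun_alg_bounded_on R _) (bX i j k) (bX i j k)).
by apply.
Qed.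

Let P2 := (P \x P)%E : probability _ R.
(** The two components of a point of the product space carry independent copies of the whole
    family. *)
Let F2 : Omega * Omega -> family_space (bool * 'I_N)%type mat :=
  fun w p => E p.2 (if p.1 then w.2 else w.1).

Lemma iid_two_copies : iid nu P2 F2.
Proof.
split=> [[b i]|A mA].
  by case: b => /=; apply: measurableT_comp.
have mB b : measurable [set w | forall i, A (b, i) (F w i)].
  rewrite (_ : mkset _ = F @^-1` [set x | forall i, A (b, i) (x i)]) //.
  rewrite -[X in measurable X]setTI; apply: (measurable_family iid_binomial.1) => //.
  by apply: sub_sigma_algebra; exists (fun i => A (b, i)).
rewrite (_ : mkset _ = [set w | forall i, A (false, i) (F w i)] `*`
                       [set w | forall i, A (true, i) (F w i)]); last first.
  apply/seteqP; split=> [[w w'] Aw|[w w'] [/= Aw Aw'] [[] i]] /=.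
  - by split=> i /=; [exact: (Aw (false, i)) | exact: (Aw (true, i))].
  - exact: Aw'.
  - exact: Aw.
have PA b : P [set w | forall i, A (b, i) (F w i)] = (\prod_i nu (A (b, i)))%E.
  exact: (iid_binomial.2 (fun i => A (b, i))).
transitivity (P [set w | forall i, A (false, i) (F w i)] *
              P [set w | forall i, A (true, i) (F w i)])%E.
  exact: product_measure1E.
rewrite !PA.
rewrite (eq_bigr (fun p => (fun b i => nu (A (b, i))) p.1 p.2)) => [|[]//].
by rewrite -(pair_bigA _ (fun b i => nu (A (b, i)))) big_bool muleC.
Qed.

Let T2 w (b : bool) : mat := \sum_(i < N) F2 w (b, i).

Let measurable_copy b : measurable_fun setT (fun w => T2 w b).
Proof.
apply/measurable_mxP; apply: mx_in_sum; first exact: fun_alg_measurable.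
by move=> i; apply/measurable_mxP; exact: iid_two_copies.1.
Qed.

Lemma iid_copy_sums : iid mu P2 (T2 : _ -> family_space bool mat).
Proof.
split=> [b|A mA]; first exact: measurable_copy.
have mS : measurable_fun setT (fun w => \sum_(i < N) E i w : mat).
  exact: (measurable_total iid_binomial).
have mSA b : measurable ((fun w => \sum_(i < N) E i w : mat) @^-1` A b).
  by rewrite -[X in measurable X]setTI; exact: mS.
rewrite (_ : mkset _ = ((fun w => \sum_(i < N) E i w : mat) @^-1` A false) `*`
                       ((fun w => \sum_(i < N) E i w : mat) @^-1` A true)); last first.
  apply/seteqP; split=> [[w w'] Aw|[w w'] [/= Aw Aw'] []] /=.
  - by split; [exact: (Aw false) | exact: (Aw true)].
  - exact: Aw'.
  - exact: Aw.
by rewrite big_bool /= muleC !muE //; exact: product_measure1E.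
Qed.

Let copies_total : matrix_total F2 = (fun w => T2 w false + T2 w true).
Proof.
apply/funext => w; rewrite /matrix_total addrC.
rewrite (eq_bigr (fun p => (fun b i => F2 w (b, i)) p.1 p.2)) => [|[]//].
by rewrite -(pair_bigA _ (fun b i => F2 w (b, i))) big_bool.
Qed.

Let copies_difference :
  weighted_total F2 (@copy_sign R N) = (fun w => T2 w false - T2 w true).
Proof.
apply/funext => w; rewrite /weighted_total addrC.
pose signed (b : bool) i := rscale ((-1) ^+ b) (F2 w (b, i)).
rewrite (eq_bigr (fun p => signed p.1 p.2)) => [|[]//].
rewrite -(pair_bigA _ signed) big_bool /=; congr (_ + _).
  by rewrite raddf_sum; apply: eq_bigr => i _; rewrite /signed expr1 rscaleN1.
by apply: eq_bigr => i _; rewrite /signed expr0 rscale1.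
Qed.

(** * Transfer to arbitrary independent variables with the binomial law *)

Section transfer.
Variables (d' : measure_display) (Om : measurableType d') (P' : probability Om R).
Variables (X Y : {RV P' >-> mat}).
Hypotheses (indepXY : independent2 X Y) (lawX : has_law X mu) (lawY : has_law Y mu).

Let XY w (b : bool) : mat := if b then Y w else X w.

Let iid_XY : iid mu P' (XY : _ -> family_space bool mat).
Proof.
split=> [b|A mA].
  by case: b; exact: measurable_funPT.
rewrite (_ : mkset _ = (X @^-1` A false) `&` (Y @^-1` A true)); last first.
  apply/seteqP; split=> [w Aw|w [/= Aw Aw'] []] //.
  by split; [exact: (Aw false) | exact: (Aw true)].
rewrite (indepXY (mA false) (mA true)) big_bool /= -(lawX (mA false)) -(lawY (mA true)).
exact: muleC.
Qed.

(** Stands in for the event that all summands are projections, which makes no sense for variables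
    given only by their law. *)
Let G' := [set w | forall b, @bounded_mats R beta n N%:R (XY w b)].

Let mG' : measurable G'.
Proof.
have mB := @measurable_bounded_mats R beta n N%:R.
rewrite (_ : G' = (X @^-1` (@bounded_mats R beta n N%:R)) `&`
                  (Y @^-1` (@bounded_mats R beta n N%:R))).
  by apply: measurableI; rewrite -[X in measurable X]setTI; exact: measurable_funPT.
apply/seteqP; split=> [w Aw|w [/= Aw Aw'] []] //.
by split; [exact: (Aw false) | exact: (Aw true)].
Qed.

Let PG' : P' G' = 1%E.
Proof.
rewrite [LHS](iid_XY.2 (fun=> @bounded_mats R beta n N%:R)).
  by rewrite big1 // => b _; exact: binomial_bounded.
by move=> _; exact: measurable_bounded_mats.
Qed.

Let bdd' := @bounded_on R _ _ G'.
Let bdd2 := @bounded_on R _ _ (all_projections F2).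
Let bdd'A : fun_alg bdd' := fun_alg_bounded_on R G'.
Let bdd2A : fun_alg bdd2 := fun_alg_bounded_on R (all_projections F2).

Let bounded_XY b : mx_in bdd' (fun w => XY w b).
Proof.
by apply: (mx_in_bounded_on (M := N%:R)) => [|w]; [exact: iid_XY.1 | exact].
Qed.

Let bounded_copy b : mx_in bdd2 (fun w => T2 w b).
Proof. by apply: (mx_in_sum bdd2A) => i; exact: bounded_iid iid_two_copies _. Qed.

(* The hypothesis on [g] says that its coordinates are polynomials in those of
   its arguments. *)
Lemma transfer_mean (g : (bool -> mat) -> mat) (A : set mat) (i j : 'I_n) k :
  measurable A ->
  (forall (T : Type) (Q : (T -> R) -> Prop) (f : T -> bool -> mat), fun_alg Q ->
    (forall b, mx_in Q (fun t => f t b)) -> mx_in Q (fun t => g (f t))) ->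
  (\int[P']_(w in [set w | A (X w + Y w)%R]) (scoord k (g (XY w) i j))%:E =
   (restricted_mean P2 F2 A (fun w => scoord k (g (T2 w) i j)))%:E)%E.
Proof.
move=> mA gP.
pose s (x : family_space bool mat) : mat := x false + x true.
pose phi (x : family_space bool mat) : R := \1_A (s x) * scoord k (g x i j).
have mc b : mx_in (fun u => measurable_fun setT u)
    (fun x : family_space bool mat => x b : mat).
  by apply/measurable_mxP; exact: measurable_family_coord.
have ms : measurable_fun setT s.
  by apply/measurable_mxP; apply: mx_inD => //; exact: fun_alg_measurable.
have mA1 : measurable_fun setT (\1_A : mat -> R) by exact: measurable_indic.
have mphi : measurable_fun setT phi.
  apply: measurable_funM; first exact: measurableT_comp mA1 ms.
  (* [gP] serves three algebras: here measurable functions on the family space, then the bounded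
     functions on each of the two probability spaces. *)
  by apply: gP; first exact: fun_alg_measurable.
have int1 : P'.-integrable setT (EFin \o (phi \o (XY : _ -> family_space bool mat))).
  apply: (bounded_on_integrable mG' PG'); apply: (fun_algM bdd'A).
    apply: bounded_on_indic => //; apply: measurableT_comp ms _.
    exact: measurable_family iid_XY.1.
  exact: gP.
have bphi2 : bdd2 (phi \o (T2 : _ -> family_space bool mat)).
  apply: (fun_algM bdd2A).
    apply: bounded_on_indic => //; apply: measurableT_comp ms _.
    exact: measurable_family iid_copy_sums.1.
  exact: gP.
have int2 := bounded_on_integrable (measurable_all_projections iid_two_copies)
  (all_projections_as nuQ iid_two_copies) bphi2.
transitivity (\int[P']_w (phi (XY w))%:E)%E.
  rewrite integral_mkcond; apply: eq_integral => w _.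
  rewrite patchE /phi /s /= indicE.
  rewrite (_ : (w \in _) = (X w + Y w \in A)); last by apply/idP/idP; rewrite !inE.
  by case: ifP; rewrite ?mul1r ?mul0r.
rewrite (iid_same_integral iid_XY iid_copy_sums mphi int1 int2).
rewrite /restricted_mean copies_total /Rintegral fineK //.
exact: integrable_fin_num int2.
Qed.

Lemma binomial_cond_exp :
  is_mat_cond_exp P' (fun w => X w + Y w : mat)
    (fun w => (X w - Y w) *m (X w - Y w))
    (fun w => meixner_quadratic N (X w + Y w)).
Proof.
move=> i j k.
have quadP (T : Type) (Q : (T -> R) -> Prop) (f : T -> mat) :
    fun_alg Q -> mx_in Q f -> mx_in Q (fun t => meixner_quadratic N (f t)).
  move=> QA Qf; do ![apply: mx_inD => // | apply: mx_in_rscale => //].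
    exact: mx_inM.
  exact: mx_in_cst.
have sumP (T : Type) (Q : (T -> R) -> Prop) (f : T -> bool -> mat) : fun_alg Q ->
    (forall b, mx_in Q (fun t => f t b)) ->
    mx_in Q (fun t => meixner_quadratic N (f t false + f t true)).
  by move=> QA Qf; apply: quadP => //; apply: mx_inD.
have sqrP (T : Type) (Q : (T -> R) -> Prop) (f : T -> bool -> mat) : fun_alg Q ->
    (forall b, mx_in Q (fun t => f t b)) ->
    mx_in Q (fun t => (f t false - f t true) *m (f t false - f t true) : mat).
  by move=> QA Qf; apply: mx_inM => //; apply: mx_inD => //; exact: mx_inN.
split.
- by apply: (bounded_on_integrable mG' PG'); exact: (sqrP _ _ XY).
- by apply: (bounded_on_integrable mG' PG'); exact: (sumP _ _ XY).
- move=> B mB.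
  (* The candidate is a measurable function of the sum, so its preimages are preimages under the
     sum. *)
  exists ((fun x : mat => scoord k (meixner_quadratic N x i j)) @^-1` B); last first.
    by rewrite setTI.
  rewrite -[X in measurable X]setTI.
  apply: (quadP _ (fun u => measurable_fun setT u) id (fun_alg_measurable _ _)) => //.
  exact/measurable_mxP.
(* An event generated by the sum is its preimage of some [A], so both integrals become restricted
   means on the product space. *)
- move=> _ [A mA <-]; rewrite setTI.
  rewrite [LHS](@transfer_mean (fun x => meixner_quadratic N (x false + x true))) //.
  rewrite [RHS](@transfer_mean (fun x => (x false - x true) *m (x false - x true))) //.
  have := two_copies_meixner N_ge1 nuQ iid_two_copies mA i j k.
  by rewrite copies_total copies_difference => ->.
Qed.
End transfer.
End binomial.

Theorem proposition3p5 (R : realType) (beta n N : nat)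
    (beta_dyson : beta \in [:: 1; 2; 4]%N) (n_ge1 : (1 <= n)%N) (N_ge1 : (1 <= N)%N)
    (h : probability (mat R beta n) R) (h_haar : is_haar h)
    (q : nat -> R) (q_ge0 : forall m : nat, (1 <= m <= n)%N -> 0 <= q m)
    (q_le1 : \sum_(1 <= m < n.+1) q m <= 1)
    (mu : probability (mat R beta n) R) (mu_bin : is_binomial_ensemble h N q mu) :
  is_meixner mu (- (1 / (2 * N%:R - 1))) (2 * N%:R / (2 * N%:R - 1)) 0.
Proof.
case: mu_bin => d [W [P [E [indepE lawE muE]]]].
split.
- exact (binomial_herm n_ge1 h_haar indepE lawE muE).
- exact (binomial_rotation h_haar indepE lawE muE).
- exact (binomial_second_moments n_ge1 h_haar indepE lawE muE).
- move=> d' Om P' X Y iXY lX lY S D.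
  exact (binomial_cond_exp n_ge1 N_ge1 h_haar indepE lawE muE iXY lX lY).
Qed.
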